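(* Let $C_1,\ldots,C_m\subset\mathbb{R}^p$ ($m\ge 1$) be nonempty closed convex sets, let $\ell:\mathbb{R}^p\to\mathbb{R}$ be a function, and for $\nu>0$ put $$f_\nu(x)=\ell(x)+\frac{\nu}{2}\sum_{i=1}^m \operatorname{dist}(x,C_i)^2 .$$ Let $\kappa>0$ and $\mu$ be constants such that: (a) $\ell$ is continuously differentiable and $x\mapsto \ell(x)+\frac{\kappa}{2}\|x\|^2$ is convex; (b) $f_\kappa$ is coercive, i.e. $\lim_{\|x\|\to\infty} f_\kappa(x)=\infty$; (c) $\mu>\kappa$. Let $x_0\in\mathbb{R}^p$ be arbitrary and let $(x_n)_{n\ge 0}$ be the MM iterates for the problem $\min_{x\in\mathbb{R}^p} f_\mu(x)$, that is, $$x_{n+1}=\underset{y\in\mathbb{R}^p}{\arg\min}\; g_\mu(y\mid x_n),\qquad g_\mu(y\mid x)=\ell(y)+\frac{\mu}{2}\sum_{i=1}^m\|y-P_{C_i}(x)\|^2 .$$ Then every cluster point of $(x_n)$ is a stationary point of $f_\mu$. If the number of stationary points of $f_\mu$ is finite, then the sequence $(x_n)$ converges. Finally, if $f_\mu$ has a unique stationary point, then $(x_n)$ converges to that stationary point, which globally minimizes $f_\mu$ over $\mathbb{R}^p$.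
   Context: $\|\cdot\|$ is the Euclidean norm on $\mathbb{R}^p$. For a nonempty closed convex set $C\subset\mathbb{R}^p$, $\operatorname{dist}(x,C)=\inf_{y\in C}\|x-y\|$, and $P_C(x)$ denotes the Euclidean projection of $x$ onto $C$ (the unique point of $C$ nearest to $x$). The function $x\mapsto\operatorname{dist}(x,C)^2$ is differentiable with gradient $2[x-P_C(x)]$. A stationary point of $f_\mu$ is a point $x$ with $\nabla f_\mu(x)=\nabla\ell(x)+\mu\sum_{i=1}^m[x-P_{C_i}(x)]=0$. The function $\ell$ is not assumed to be convex. MM stands for majorization-minimization: $g_\mu(\cdot\mid x)$ majorizes $f_\mu$ at $x$, meaning $g_\mu(x\mid x)=f_\mu(x)$ and $g_\mu(y\mid x)\ge f_\mu(y)$ for all $y$. *)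

(* Defs.v *)
(* MathComp-Analysis: [R : realType] is the field of real numbers and R^p is
   ['rV[R]_p].  The library norm [`|x|] on ['rV[R]_p] is the sup norm; it induces
   the same topology as [enorm], so the library's [closed], [cluster], [-->],
   [continuous] and [differentiable] are the usual Euclidean notions. *)
From HB Require Import structures.
From mathcomp Require Import all_boot all_order all_algebra.
From mathcomp Require Import all_classical all_reals all_analysis.
Set Implicit Arguments.
Unset Strict Implicit.
Unset Printing Implicit Defensive.
Import Order.TTheory GRing.Theory Num.Theory.
Import numFieldNormedType.Exports.
Local Open Scope classical_set_scope.
Local Open Scope ring_scope.

Section Definitions.
Context {R : realType} {p : nat}.
Implicit Types (x y : 'rV[R]_p) (C : set 'rV[R]_p) (f l : 'rV[R]_p -> R).

Definition enorm x : R := Num.sqrt (\sum_(i < p) x ord0 i ^+ 2).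

Definition dist x C : R := inf [set enorm (x - y) | y in C].

Definition argmin f : set 'rV[R]_p := [set y | forall z, f y <= f z].

(* [get] selects an element of the set of points of [C] nearest to [x]; for [C]
   nonempty, closed and convex this set is a singleton. *)
Definition proj C x : 'rV[R]_p :=
  get [set y | C y /\ forall z, C z -> enorm (x - y) <= enorm (x - z)].

Definition gradient f x : 'rV[R]_p := \row_(i < p) 'D_(delta_mx ord0 i) f x.

(* Differentiability is required because ['D_v f x] is a default value when the
   directional derivative does not exist. *)
Definition stationary f : set 'rV[R]_p :=
  [set x | differentiable f x /\ gradient f x = 0].

Definition continuously_differentiable f :=
  (forall x, differentiable f x) /\ continuous (gradient f).

Definition coercive f :=
  forall A : R, exists r : R, forall x, r < enorm x -> A < f x.

Definition penalized m (C : 'I_m -> set 'rV[R]_p) l (nu : R) x : R :=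
  l x + nu / 2 * \sum_(i < m) dist x (C i) ^+ 2.

(* [surrogate C l mu x y] is g_mu(y | x), with the anchor [x] first. *)
Definition surrogate m (C : 'I_m -> set 'rV[R]_p) l (mu : R) x y : R :=
  l y + mu / 2 * \sum_(i < m) enorm (y - proj (C i) x) ^+ 2.

(* The set [argmin (surrogate C l mu (x_ n))] is a singleton when
   l + kappa/2 |.|^2 is convex, kappa < mu and m > 0, since the surrogate is then
   strongly convex. *)
Definition MM_iterates m (C : 'I_m -> set 'rV[R]_p) l (mu : R)
    (x_ : nat -> 'rV[R]_p) :=
  forall n, argmin (surrogate C l mu (x_ n)) (x_ n.+1).

End Definitions.

(* Main.v *)
Require Import Defs.
From HB Require Import structures.
From mathcomp Require Import all_boot all_order all_algebra.
From mathcomp Require Import all_classical all_reals all_analysis.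
From mathcomp Require Import ring lra.
Import Order.TTheory GRing.Theory Num.Theory.
Import numFieldNormedType.Exports.
Local Open Scope classical_set_scope.
Local Open Scope ring_scope.

(** Write f for the penalized objective and g(. | x) for the surrogate anchored
at x. Since the projection onto C_i is a point of C_i at distance dist(x, C_i)
from x, the surrogate majorizes f and touches it at its anchor.

Each surrogate is the sum of the convex function l + kappa/2 |.|^2 and of a
quadratic of curvature mu m - kappa > 0, so it exceeds its minimum by at least a
multiple of the squared distance to the minimizer [surrogate_strong_min]. With
majorization this gives a sufficient decrease [MM_descent]: f(x_(n+1)) is below
f(x_n) by a multiple of |x_n - x_(n+1)|^2. As f is coercive and continuous, it is
bounded below and has compact sublevel sets; hence the steps x_(n+1) - x_n tend
to 0 [MM_steps_vanish] and the iterates stay in a compact set.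

At a cluster point z, monotonicity gives f(z) <= f(x_n) for all n, so
g(y | x_n) >= g(x_(n+1) | x_n) >= f(x_(n+1)) >= f(z) = g(z | z) for all y. The
projections are continuous, so z inherits g(y | z) >= g(z | z): the point z
minimizes its own surrogate. Then z also minimizes g(. | z) - f, whose minimum
value is 0, and Fermat's rule for g(. | z) and for g(. | z) - f together gives
the vanishing of the gradient of f at z [fixed_point_stationary]. The
differentiability of f comes from the second-order expansion of a squared
distance [sqr_dist_expansion].

A sequence in a compact set whose steps vanish cannot jump over an annulus free
of cluster points; with finitely many cluster points it therefore converges
[cvg_seq_finite_cluster]. Finally, f attains its minimum, at a stationary point
by Fermat's rule, so a unique stationary point is both the limit and the global
minimizer. *)

(** Metric projection, as opposed to the coordinate projection of a product. *)
Local Notation proj := Defs.proj.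

(** * Sequences in compact sets *)

Lemma cluster_seq_closed (T : topologicalType) (u : nat -> T) (A : set T)
    (z : T) :
  closed A -> (\forall n \near \oo, A (u n)) -> cluster (u @ \oo) z -> A z.
Proof. by move=> cA uA uz; apply: cA => B; apply: uz. Qed.

(** Otherwise the indices with values in B carry a proper filter finer than the
one at infinity, and compactness yields a cluster point in B. *)
Lemma eventually_avoids_compact (T : topologicalType) (u : nat -> T) (B : set T) :
  compact B -> B `&` cluster (u @ \oo) = set0 -> \forall n \near \oo, ~ B (u n).
Proof.
move=> cB B0; apply: contrapT => freqB.
pose F := u @ within [set n | B (u n)] \oo.
have PF : ProperFilter F.
  apply: fmap_proper_filter; apply: Build_ProperFilter_ex => D wD.
  apply: contrapT => noD; apply: freqB.
  apply: (@filterS _ \oo _ [set n | B (u n) -> D n]) wD => n DB Bn.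
  by apply: noD; exists n; exact: DB.
have [|v [Bv Fv]] := cB F PF.
  exact: (@withinT _ \oo [set n | B (u n)]).
have : (B `&` cluster (u @ \oo)) v.
  split=> //; apply: cvg_cluster Fv => P.
  by rewrite /F /= => uP; apply: cvg_within uP.
by rewrite B0.
Qed.

(** The finite cluster set leaves around one of its points z an annulus without
cluster points, which the sequence eventually avoids. A late term close to z
cannot be followed by one beyond the annulus, the steps being shorter than the
width of the annulus, so the sequence stays close to z. *)
Lemma cvg_seq_finite_cluster (R : realFieldType) (V : normedModType R)
    (A : set V) (u : nat -> V) :
  compact A -> (forall n, A (u n)) ->
  (forall e, 0 < e -> \forall n \near \oo, `|u n.+1 - u n| < e) ->
  finite_set (cluster (u @ \oo)) -> cvg (u @ \oo).
Proof.
move=> cA uA du Kfin.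
have [|z [_ uz]] := cA (u @ \oo) _; first by exists 0%N => // n _; exact: uA.
have [e e0 eK] : exists2 e : R, 0 < e &
    forall v, `|z - v| < e -> cluster (u @ \oo) v -> v = z.
  have cK : closed (cluster (u @ \oo) `\ z).
    apply: (accessible_finite_set_closed.1 _); last exact: finite_setD.
    by apply: hausdorff_accessible; exact: norm_hausdorff.
  have : nbhs z (~` (cluster (u @ \oo) `\ z)).
    by apply: open_nbhs_nbhs; split; [exact: closed_openC | case=> _; exact].
  move=> /nbhs_ballP [e /= e0 eK]; exists e => // v zv vK.
  apply: contrapT => vz; apply: (eK v); last by split.
  by rewrite -ball_normE.
apply/cvg_ex; exists z; apply/cvgrPdist_lt => d d0.
(* The annulus has radii r / 2 and r, with r < e so as to contain no cluster
   point, and r <= d so that staying inside it gives the required bound. *)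
pose r := Num.min d (e / 2).
have r0 : 0 < r by rewrite lt_min d0 divr_gt0.
have rd : r <= d by rewrite ge_min lexx.
have re : r < e by rewrite gt_min; apply/orP; right; lra.
pose B := A `&` [set v | r / 2 <= `|z - v| <= r].
have cB : compact B.
  apply: compact_closedI => //.
  rewrite [X in closed X](_ : _ = (fun v => `|z - v|) @^-1` `[r / 2, r]%classic);
    last by apply/seteqP; split=> v /=; rewrite in_itv.
  apply: preimage_closed; last exact: interval_closed.
  by move=> v _; apply: cvg_norm; apply: cvgB; [exact: cvg_cst | exact: cvg_id].
have B0 : B `&` cluster (u @ \oo) = set0.
  apply/seteqP; split=> // v [[_ /= /andP[rv vr]] vK].
  by move: rv; rewrite (eK v) ?(le_lt_trans vr)// subrr normr0; lra.
have r20 : 0 < r / 2 by lra.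
have [N _ HN] : \forall n \near \oo, ~ B (u n) /\ `|u n.+1 - u n| < r / 2.
  by apply: filterI; [exact: eventually_avoids_compact | exact: du].
have tailN : (u @ \oo) [set u n | n in [set n | (N <= n)%N]].
  by exists N => // n Nn; exists n.
have [_ [[n Nn <-]]] := uz _ _ tailN (nbhsx_ballx z _ r20).
rewrite -ball_normE /= => zn.
have close k : `|z - u (n + k)%N| < r / 2.
  elim: k => [|k IHk]; first by rewrite addn0.
  have Nk : (N <= n + k)%N by rewrite (leq_trans Nn)// leq_addr.
  have [_ step] := HN _ Nk; have [notB _] := HN (n + k).+1 (leqW Nk).
  rewrite addnS ltNge; apply/negP => far; apply: notB; split=> //=.
  rewrite far /= -[z](subrK (u (n + k)%N)) -addrA.
  apply: (le_trans (ler_normD _ _)).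
  by rewrite [leRHS]splitr lerD ?ltW// distrC.
exists n => // k /= nk; rewrite -(subnKC nk).
by apply: lt_le_trans (close _) _; lra.
Qed.

(** * Euclidean geometry and differentiability *)

Definition dot {R : realType} {p : nat} (x y : 'rV[R]_p) : R :=
  \sum_(i < p) x ord0 i * y ord0 i.

Section Euclidean.
Context {R : realType} {p : nat}.
Implicit Types (x y z : 'rV[R]_p) (a : R) (f g : 'rV[R]_p -> R).

Lemma dotC x y : dot x y = dot y x.
Proof. by apply: eq_bigr => i _; rewrite mulrC. Qed.

Lemma dotDl x y z : dot (x + y) z = dot x z + dot y z.
Proof. by rewrite -big_split; apply: eq_bigr => i _; rewrite mxE mulrDl. Qed.

Lemma dotZl a x y : dot (a *: x) y = a * dot x y.
Proof. by rewrite mulr_sumr; apply: eq_bigr => i _; rewrite mxE mulrA. Qed.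

Lemma dotNl x y : dot (- x) y = - dot x y.
Proof. by rewrite -scaleN1r dotZl mulN1r. Qed.

Lemma dotDr x y z : dot x (y + z) = dot x y + dot x z.
Proof. by rewrite dotC dotDl !(dotC x). Qed.

Lemma dotZr a x y : dot x (a *: y) = a * dot x y.
Proof. by rewrite dotC dotZl dotC. Qed.

Lemma dotNr x y : dot x (- y) = - dot x y.
Proof. by rewrite dotC dotNl dotC. Qed.

Lemma dotxx_ge0 x : 0 <= dot x x.
Proof. by apply: sumr_ge0 => i _; rewrite -expr2 sqr_ge0. Qed.

Definition dotE := (dotDl, dotDr, dotNl, dotNr, dotZl, dotZr).

Lemma dot_sqrB x y : dot (x - y) (x - y) = dot x x - 2 * dot x y + dot y y.
Proof. by rewrite !dotE (dotC y x); ring. Qed.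

Lemma sqr_enorm x : enorm x ^+ 2 = dot x x.
Proof.
rewrite sqr_sqrtr; last by apply: sumr_ge0 => i _; rewrite sqr_ge0.
by apply: eq_bigr => i _; rewrite expr2.
Qed.

Lemma enorm_ge0 x : 0 <= enorm x.
Proof. exact: sqrtr_ge0. Qed.

Lemma ler_enorm x y : (enorm x <= enorm y) = (dot x x <= dot y y).
Proof. by rewrite -!sqr_enorm ler_sqr ?nnegrE ?enorm_ge0. Qed.

(** The norm of row vectors is the maximum of the absolute values of the entries;
this bound and the next one transfer topological facts between the two norms. *)
Lemma mx_norm_le_enorm x : `|x| <= enorm x.
Proof.
rewrite {1}/Num.norm /= mx_normrE; apply/bigmax_leP; split=> [|[i j] _ /=].
  exact: enorm_ge0.
rewrite -(ler_sqr) ?nnegrE ?enorm_ge0// sqr_enorm /dot (bigD1 j)//= ord1.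
rewrite -normrX ger0_norm ?sqr_ge0// expr2 lerDl.
by apply: sumr_ge0 => k _; rewrite -expr2 sqr_ge0.
Qed.

Lemma sqr_enorm_le_mx_norm x : enorm x ^+ 2 <= p%:R * `|x| ^+ 2.
Proof.
rewrite sqr_enorm.
have -> : p%:R * `|x| ^+ 2 = \sum_(i < p) `|x| ^+ 2.
  by rewrite sumr_const card_ord mulr_natl.
apply: ler_sum => i _; rewrite -expr2 -[leLHS]ger0_norm ?sqr_ge0// normrX ler_sqr ?nnegrE//.
rewrite {2}/Num.norm /= mx_normrE.
exact: (le_bigmax _ (fun ij => `|x ij.1 ij.2|) (ord0, i)).
Qed.

Lemma differentiable_dot x y : differentiable (dot x) y.
Proof.
have -> : dot x = \sum_(i < p) (fun z => x ord0 i *: (z ord0 i : R)).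
  by apply/funext => z; rewrite fct_sumE.
apply: differentiable_sum => i.
by apply: differentiableZ; exact: differentiable_coord.
Qed.

Lemma differentiable_sqr_enorm x y :
  differentiable (fun z => enorm (z - x) ^+ 2) y.
Proof.
have -> : (fun z => enorm (z - x) ^+ 2) =
    \sum_(i < p) (((fun z : 'rV[R]_p => z ord0 i : R) - cst (x ord0 i)) ^+ 2).
  apply/funext => z; rewrite fct_sumE sqr_enorm.
  by apply: eq_bigr => i _; rewrite !fctE !mxE expr2.
apply: differentiable_sum => i; apply: differentiableX.
by apply: differentiableB; [exact: differentiable_coord | exact: differentiable_cst].
Qed.

(** The square is differentiable everywhere, unlike the norm. *)
Lemma continuous_enorm x : continuous (fun z => enorm (z - x)).
Proof.
have -> : (fun z => enorm (z - x)) = Num.sqrt \o (fun z => enorm (z - x) ^+ 2).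
  by apply/funext => z /=; rewrite sqrtr_sqr ger0_norm ?enorm_ge0.
move=> z; apply: continuous_comp; last exact: sqrt_continuous.
exact/differentiable_continuous/differentiable_sqr_enorm.
Qed.

(** Such a function is a little o of the displacement, hence has differential 0. *)
Lemma differentiable_quadratic f x a :
  0 <= a -> (forall z, `|f z| <= a * enorm (z - x) ^+ 2) -> differentiable f x.
Proof.
move=> a0 fa.
have fx0 : f x = 0.
  apply/normr0_eq0/le_anti; rewrite normr_ge0 andbT (le_trans (fa x))//.
  by rewrite subrr sqr_enorm -(scale0r 0) dotZl mul0r mulr0.
pose b := a * p%:R + 1.
have b0 : 0 < b by rewrite ltr_wpDl// mulr_ge0.
have fo : f \o shift x = cst (f x) +
    (\0 : {linear 'rV[R]_p -> R}) +o_ (0 : 'rV[R]_p) id.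
  apply/eqaddoP => e e0; near=> h.
  rewrite !fctE /= fx0 addr0 subr0.
  apply: (le_trans (fa _)); rewrite addrK.
  apply: (@le_trans _ _ (b * `|h| ^+ 2)).
    apply: (le_trans (ler_wpM2l a0 (sqr_enorm_le_mx_norm h))).
    by rewrite mulrA ler_wpM2r ?sqr_ge0// lerDl.
  rewrite expr2 mulrA ler_wpM2r// mulrC -ler_pdivlMr//.
  near: h; exact: (@nbhs0_le _ 'rV[R]_p _ (divr_gt0 e0 b0)).
apply/diff_locallyP; rewrite (@diff_unique _ _ _ f \0)//.
  by split=> //; exact: cst_continuous.
exact: cst_continuous.
Unshelve. all: by end_near. Qed.

(** Fermat's rule along the coordinate lines through x, where the restriction of f
is a differentiable function of one variable with a minimum at 0. *)
Lemma gradient_argmin f x :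
  (forall y, differentiable f y) -> argmin f x -> gradient f x = 0.
Proof.
move=> df fx; apply/rowP => i; rewrite !mxE.
set v := delta_mx _ _.
pose phi (t : R) := f (t *: v + x).
have -> : 'D_v f x = 'D_1 phi 0.
  rewrite /derive; set g1 := fun h => h^-1 *: _; set g2 := fun h => h^-1 *: _.
  suff -> : g1 = g2 by []; apply/funext => h; rewrite /g1 /g2 /=.
  by rewrite /phi addr0 scale0r add0r [_%:A]mulr1.
suff [_ ->] : is_derive (0 : R) 1 phi 0 by [].
apply: (@derive1_at_min _ phi (-1) 1 0) => [|t _||t _]; first by lra.
- by apply/derivable1_diffP; apply: differentiable_comp.
- by rewrite in_itv /=; lra.
- by rewrite /phi scale0r add0r; exact: fx.
Qed.

End Euclidean.

(** * Minimization and metric projections *)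

Section Minimization.
Context {R : realType} {p : nat}.
Implicit Types (x y z : 'rV[R]_p) (f : 'rV[R]_p -> R) (A : set 'rV[R]_p).

Lemma compact_sublevel A f (c r : R) :
  closed A -> continuous f -> (forall y, A y -> f y <= c -> `|y| <= r) ->
  compact (A `&` [set y | f y <= c]).
Proof.
move=> cA cf Ar; apply: bounded_closed_compact.
  exists r; split=> [|M rM y [Ay fy]]; first exact: num_real.
  exact: le_trans (Ar _ Ay fy) (ltW rM).
apply: closedI => //.
rewrite [X in closed X](_ : _ = f @^-1` `]-oo, c]%classic); last first.
  by apply/seteqP; split=> y /=; rewrite in_itv.
by apply: preimage_closed; [move=> y _; exact: cf | exact: interval_closed].
Qed.

(** A minimizer over A can be sought in the part of A where f is at most f x,
which is compact. *)
Lemma closed_min A f x r :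
  closed A -> A x -> continuous f ->
  (forall y, A y -> f y <= f x -> `|y| <= r) ->
  exists2 y, A y & forall z, A z -> f y <= f z.
Proof.
move=> cA Ax cf Ar.
have [|||y /set_mem[Ay yx] ymin] := @compact_EVT_min _ _ f
    (A `&` [set y | f y <= f x]).
- by exists x; split=> /=.
- exact: compact_sublevel Ar.
- exact: continuous_subspaceT.
exists y => // z Az; have [zx|/ltW xz] := leP (f z) (f x).
  by apply: ymin; apply/mem_set.
exact: le_trans yx xz.
Qed.

Lemma coercive_compact_sublevel f c :
  continuous f -> coercive f -> compact [set y | f y <= c].
Proof.
move=> cf /(_ c)[r fr]; rewrite -[X in compact X]setTI.
apply: (@compact_sublevel _ _ _ r) => // y _ yc.
apply: (le_trans (mx_norm_le_enorm y)).
by rewrite leNgt; apply/negP => /fr; rewrite ltNge yc.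
Qed.

Lemma coercive_argmin f : continuous f -> coercive f -> argmin f !=set0.
Proof.
move=> cf /(_ (f 0))[r fr].
have [|y _ ymin] := @closed_min setT f 0 r closedT I cf.
  move=> y _ yc; apply: (le_trans (mx_norm_le_enorm y)).
  by rewrite leNgt; apply/negP => /fr; rewrite ltNge yc.
by exists y => z; exact: ymin.
Qed.

End Minimization.

Section Projection.
Context {R : realType} {p : nat}.
Implicit Types (x y z : 'rV[R]_p) (t : R).

Lemma convex_setP (C : set 'rV[R]_p) x y t : convex_set C ->
  C x -> C y -> 0 <= t <= 1 -> C (t *: x + (1 - t) *: y).
Proof.
move=> cC Cx Cy /andP[t0 t1].
exact/set_mem/(cC x y (Itv01 t0 t1) (mem_set Cx) (mem_set Cy)).
Qed.

Variable C : set 'rV[R]_p.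
Hypotheses (C0 : C !=set0) (Cclosed : closed C) (Cconvex : convex_set C).

Lemma projP x :
  C (proj C x) /\ forall z, C z -> enorm (x - proj C x) <= enorm (x - z).
Proof.
have [w Cw] := C0.
have enormB u v : enorm (u - v) = enorm (v - u).
  by rewrite /enorm; congr Num.sqrt; apply: eq_bigr => i _; rewrite -sqrrN !mxE opprB.
have [|y Cy ymin] := @closed_min _ _ C (fun y => enorm (y - x)) w
    (`|x| + enorm (w - x)) Cclosed Cw (continuous_enorm x).
  move=> y Cy yw; rewrite -[y](subrK x) addrC (le_trans (ler_normD _ _))//.
  by rewrite lerD2l (le_trans (mx_norm_le_enorm _)).
apply: (@getPex _ [set y | C y /\ forall z, C z -> enorm (x - y) <= enorm (x - z)]).
by exists y; split=> // z Cz; rewrite enormB [leRHS]enormB ymin.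
Qed.

Lemma proj_in x : C (proj C x). Proof. by have [] := projP x. Qed.

Lemma proj_min x z : C z ->
  dot (x - proj C x) (x - proj C x) <= dot (x - z) (x - z).
Proof. by have [_ /[apply]] := projP x; rewrite ler_enorm. Qed.

Lemma dist_proj x : dist x C = enorm (x - proj C x).
Proof.
have [Cpx pmin] := projP x.
apply/le_anti/andP; split.
  apply: ge_inf; last by exists (proj C x).
  by exists 0 => _ [y _ <-]; exact: enorm_ge0.
apply: lb_le_inf; first by exists (enorm (x - proj C x)), (proj C x).
by move=> _ [y Cy <-]; exact: pmin.
Qed.

Lemma sqr_dist_le x z : C z -> dist x C ^+ 2 <= enorm (x - z) ^+ 2.
Proof. by move=> Cz; rewrite dist_proj !sqr_enorm proj_min. Qed.

(** The angle at the projection is obtuse: moving from the projection P towards z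
by a fraction t changes the squared distance to x by -2 t a + t^2 b, with a the
dot product below and b the squared distance from P to z; this would be negative
for small t if a were positive. *)
Lemma proj_variational x z : C z -> dot (x - proj C x) (z - proj C x) <= 0.
Proof.
move=> Cz; set P := proj C x; rewrite leNgt; apply/negP => a0.
set a := dot _ _ in a0; pose b := dot (z - P) (z - P).
have b0 : 0 <= b by exact: dotxx_ge0.
(* Any t in ]0, 1] with t b < 2 a will do. *)
pose t := a / (a + b).
have ab0 : 0 < a + b by rewrite ltr_wpDr.
have t0 : 0 < t by rewrite divr_gt0.
have t1 : t <= 1 by rewrite ler_pdivrMr// mul1r lerDl.
have Cw : C (t *: z + (1 - t) *: P).
  by apply: convex_setP => //; [exact: proj_in | rewrite ltW].
have := proj_min x _ Cw; rewrite -/P.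
have -> : x - (t *: z + (1 - t) *: P) = (x - P) - t *: (z - P).
  by apply/rowP => i; rewrite !mxE; ring.
rewrite [leRHS]dot_sqrB !dotZl !dotZr -/a -/b.
have tab : t * (a + b) = a by rewrite mulfVK// gt_eqF.
have ta := mulr_gt0 t0 a0; have tta := mulr_gt0 t0 ta.
have -> : t * (t * b) = t * a - t * (t * a) by rewrite -[X in t * X - _]tab; ring.
lra.
Qed.

(** Sum of the variational inequalities of x at proj y and of y at proj x. *)
Lemma proj_firmly_nonexpansive x y :
  dot (proj C y - proj C x) (proj C y - proj C x) <=
  dot (y - x) (proj C y - proj C x).
Proof.
have := proj_variational x _ (proj_in y); have := proj_variational y _ (proj_in x).
rewrite -(opprB (proj C y) (proj C x)).
set u := x - proj C x; set h := y - x; set w := proj C y - proj C x.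
have -> : y - proj C y = u + h - w.
  by rewrite /u /h /w; apply/rowP => i; rewrite !mxE; ring.
clearbody u h w; rewrite !dotE; lra.
Qed.

Lemma proj_nonexpansive x y : enorm (proj C y - proj C x) <= enorm (y - x).
Proof.
rewrite ler_enorm; have := proj_firmly_nonexpansive x y.
have := dotxx_ge0 ((y - x) - (proj C y - proj C x)); rewrite dot_sqrB; lra.
Qed.

(** The projection of x bounds the squared distance of y from above, and the
projection of y bounds that of x from above. In the second bound the linear term
is based at y, and firm nonexpansiveness compares it with the one based
at x. *)
Lemma sqr_dist_expansion x y :
  `|dist y C ^+ 2 - dist x C ^+ 2 - 2 * dot (x - proj C x) (y - x)|
    <= enorm (y - x) ^+ 2.
Proof.
have := proj_firmly_nonexpansive x y.
have := proj_min y _ (proj_in x); have := proj_min x _ (proj_in y).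
have := dotxx_ge0 ((y - x) - (proj C y - proj C x)).
rewrite !dist_proj !sqr_enorm.
set u := x - proj C x; set h := y - x; set w := proj C y - proj C x.
have -> : x - proj C y = u - w by rewrite /u /w; apply/rowP => i; rewrite !mxE; ring.
have -> : y - proj C x = u + h by rewrite /u /h; apply/rowP => i; rewrite !mxE; ring.
have -> : y - proj C y = u + h - w.
  by rewrite /u /h /w; apply/rowP => i; rewrite !mxE; ring.
clearbody u h w; rewrite !dotE (dotC h u) (dotC w u) (dotC w h) => hw xmin ymin firm.
by rewrite ler_norml; apply/andP; split; lra.
Qed.

Lemma differentiable_sqr_dist x : differentiable (fun y => dist y C ^+ 2) x.
Proof.
have -> : (fun y => dist y C ^+ 2) =
   (fun y => dist y C ^+ 2 - dist x C ^+ 2 - 2 * dot (x - proj C x) (y - x))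
   + (cst (dist x C ^+ 2 - 2 * dot (x - proj C x) x) + 2 *: dot (x - proj C x)).
  apply/funext => y; rewrite !fctE.
  rewrite dotDr dotNr /GRing.scale /=; ring.
apply: differentiableD.
  apply: (@differentiable_quadratic _ _ _ _ 1) => // y.
  by rewrite mul1r sqr_dist_expansion.
apply: differentiableD; first exact: differentiable_cst.
by apply: differentiableZ; exact: differentiable_dot.
Qed.

Lemma continuous_proj : continuous (proj C).
Proof.
move=> x; apply/(@cvgrPdist_lt _ _ _ _ (nbhs_filter x)) => e e0.
have enorm0 : enorm (x - x) = 0.
  by apply/eqP; rewrite -sqrf_eq0 sqr_enorm subrr -(scale0r 0) dotZl mul0r.
near=> y; rewrite distrC (le_lt_trans (mx_norm_le_enorm _))//.
apply: (le_lt_trans (proj_nonexpansive _ _)).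
have -> : enorm (y - x) = `|enorm (x - x) - enorm (y - x)|.
  by rewrite enorm0 sub0r normrN ger0_norm ?enorm_ge0.
near: y.
by have /(@cvgrPdist_lt _ _ _ _ (nbhs_filter x)) := continuous_enorm x x; exact.
Unshelve. all: by end_near. Qed.

End Projection.

(** * The surrogate functions *)

Lemma convex_function_midpoint (R : realType) (p : nat) (f : 'rV[R]_p -> R)
    (x y : 'rV[R]_p) :
  convex_function setT f ->
  f (2^-1 *: x + (1 - 2^-1) *: y) <= (f x + f y) / 2.
Proof.
move=> cf.
have h0 : 0 <= 2^-1 :> R by rewrite invr_ge0.
have h1 : 2^-1 <= 1 :> R by rewrite invf_le1// ler1n.
have := cf (Itv01 h0 h1) x y (mem_set I) (mem_set I).
rewrite [X in _ <= X -> _](_ : _ = 2^-1 * f x + (1 - 2^-1) * f y)//.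
by move=> /le_trans; apply; lra.
Qed.

(** The defect of the midpoint inequality for a squared distance to a point does
not depend on that point: this is what makes sums of such terms strongly
convex. *)
Lemma parallelogram (R : realType) (p : nat) (x y a : 'rV[R]_p) :
  enorm (2^-1 *: x + (1 - 2^-1) *: y - a) ^+ 2 =
  (enorm (x - a) ^+ 2 + enorm (y - a) ^+ 2) / 2 - enorm (x - y) ^+ 2 / 4.
Proof.
rewrite !sqr_enorm.
have -> : 2^-1 *: x + (1 - 2^-1) *: y - a = 2^-1 *: ((x - a) + (y - a)).
  by apply/rowP => i; rewrite !mxE; field.
have -> : x - y = (x - a) - (y - a) by rewrite opprB addrA subrK.
move: (x - a) (y - a) => u v; rewrite !dotE (dotC v u); by field.
Qed.

Lemma continuous_affine_sum (R : realType) (T : topologicalType) (m : nat)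
    (a b : R) (F : 'I_m -> T -> R) :
  (forall i, continuous (F i)) ->
  continuous (fun x => a + b * \sum_(i < m) F i x).
Proof.
move=> cF x; apply: cvgD; first exact: cvg_cst.
apply: cvgM; first exact: cvg_cst.
by apply: cvg_big => [|i _]; [exact: add_continuous | exact: cF].
Qed.

Section Majorization.
Context {R : realType} {p m : nat}.
Variables (C : 'I_m -> set 'rV[R]_p) (l : 'rV[R]_p -> R) (mu : R).
Hypotheses (C0 : forall i, C i !=set0) (Cclosed : forall i, closed (C i)).
Hypothesis Cconvex : forall i, convex_set (C i).
Hypothesis mu_ge0 : 0 <= mu.
Implicit Types x y z : 'rV[R]_p.

Lemma surrogate_diag x : surrogate C l mu x x = penalized C l mu x.
Proof.
rewrite /surrogate /penalized; congr (_ + _ * _).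
by apply: eq_bigr => i _; rewrite dist_proj.
Qed.

Lemma surrogate_majorizes x y : penalized C l mu y <= surrogate C l mu x y.
Proof.
rewrite lerD2l ler_wpM2l ?divr_ge0//; apply: ler_sum => i _.
by apply: sqr_dist_le => //; exact: proj_in.
Qed.

Lemma continuous_surrogate_anchor y :
  continuous (fun x => surrogate C l mu x y).
Proof.
apply: continuous_affine_sum => i x.
have -> : (fun x => enorm (y - proj (C i) x) ^+ 2) =
    (fun z => enorm (z - y) ^+ 2) \o proj (C i).
  apply/funext => z /=.
  by rewrite !sqr_enorm -(opprB (proj (C i) z)) dotNl dotNr opprK.
apply: continuous_comp; first exact: continuous_proj.
exact/differentiable_continuous/differentiable_sqr_enorm.
Qed.

Hypothesis l_diff : forall x, differentiable l x.

Lemma differentiable_penalized x : differentiable (penalized C l mu) x.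
Proof.
have -> : penalized C l mu =
    l + (mu / 2) *: \sum_(i < m) (fun y => dist y (C i) ^+ 2).
  by apply/funext => y; rewrite !fctE fct_sumE.
apply: differentiableD => //; apply: differentiableZ.
by apply: differentiable_sum => i; exact: differentiable_sqr_dist.
Qed.

Lemma differentiable_surrogate x y : differentiable (surrogate C l mu x) y.
Proof.
have -> : surrogate C l mu x =
    l + (mu / 2) *: \sum_(i < m) (fun y => enorm (y - proj (C i) x) ^+ 2).
  by apply/funext => z; rewrite !fctE fct_sumE.
apply: differentiableD => //; apply: differentiableZ.
by apply: differentiable_sum => i; exact: differentiable_sqr_enorm.
Qed.

Lemma argmin_penalized_stationary x :
  argmin (penalized C l mu) x -> stationary (penalized C l mu) x.
Proof.
move=> xmin; split; first exact: differentiable_penalized.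
by apply: gradient_argmin => //; exact: differentiable_penalized.
Qed.

(** Both g(. | x) and g(. | x) - f have a minimum at x, the latter because g
majorizes f with equality at the anchor; the gradient of f is the difference of
their gradients. *)
Lemma fixed_point_stationary x :
  argmin (surrogate C l mu x) x -> stationary (penalized C l mu) x.
Proof.
move=> xmin; split; first exact: differentiable_penalized.
have dg := differentiable_surrogate x; have df := differentiable_penalized.
have gg : gradient (surrogate C l mu x) x = 0 by exact: gradient_argmin.
have : gradient (surrogate C l mu x - penalized C l mu) x = 0.
  apply: gradient_argmin => [y|y]; first exact: differentiableB.
  by rewrite !fctE surrogate_diag subrr subr_ge0 surrogate_majorizes.
move=> gB; apply/rowP => i.
have /rowP/(_ i) := gB; have /rowP/(_ i) := gg; rewrite !mxE => gi.
rewrite deriveB; [|exact: diff_derivable..].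
by rewrite gi => /eqP; rewrite sub0r oppr_eq0 => /eqP.
Qed.

(** Comparing y with the midpoint w of y and z is enough: the convexity defect of
the surrogate at w is at least (mu m - kappa) / 8 times |z - y|^2, and the surrogate at w
is no less than at y. This yields half of the optimal constant, without any
limit. *)
Lemma surrogate_strong_min kappa x y z :
  convex_function setT (fun w : 'rV[R]_p => l w + kappa / 2 * enorm w ^+ 2) ->
  argmin (surrogate C l mu x) y ->
  surrogate C l mu x y + (mu * m%:R - kappa) / 4 * enorm (z - y) ^+ 2
    <= surrogate C l mu x z.
Proof.
move=> lconv ymin.
set w := 2^-1 *: z + (1 - 2^-1) *: y.
have := convex_function_midpoint _ _ _ z y lconv; rewrite -/w.
have := parallelogram _ _ z y 0; rewrite !subr0 -/w => ->.
have := ymin w; rewrite /surrogate.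
have -> : \sum_(i < m) enorm (w - proj (C i) x) ^+ 2 =
   (\sum_(i < m) enorm (z - proj (C i) x) ^+ 2 +
    \sum_(i < m) enorm (y - proj (C i) x) ^+ 2) / 2 -
    m%:R * (enorm (z - y) ^+ 2 / 4).
  under eq_bigr do rewrite parallelogram.
  by rewrite sumrB -mulr_suml big_split /= sumr_const card_ord mulr_natl.
set Sz := \sum_(i < m) enorm (z - _) ^+ 2.
set Sy := \sum_(i < m) enorm (y - _) ^+ 2.
move: (enorm (z - y) ^+ 2) (enorm z ^+ 2) (enorm y ^+ 2) => d ez ey.
lra.
Qed.

End Majorization.

(** * The iterates *)

Lemma decrease_small (R : realType) (u : nat -> R) (b e : R) :
  (forall n, u n.+1 <= u n) -> (forall n, b <= u n) -> 0 < e ->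
  \forall n \near \oo, u n - u n.+1 < e.
Proof.
move=> udec ub e0.
have /cvg_ex[L uL] : cvg (u @ \oo).
  apply: nonincreasing_is_cvgn; first exact/nonincreasing_seqP.
  by exists b => _ [n _ <-].
have uSL : u n.+1 @[n --> \oo] --> L by rewrite (cvg_shiftS u).
have uB : u n - u n.+1 @[n --> \oo] --> 0 by rewrite -(subrr L); exact: cvgB.
have /cvgrPdist_lt/(_ e e0) := uB.
apply: filterS => n; rewrite sub0r normrN => /(le_lt_trans _); apply.
exact: ler_norm.
Qed.

Section Iterates.
Context {R : realType} {p m : nat}.
Variables (C : 'I_m -> set 'rV[R]_p) (l : 'rV[R]_p -> R) (kappa mu : R).
Hypotheses (C0 : forall i, C i !=set0) (Cclosed : forall i, closed (C i)).
Hypothesis Cconvex : forall i, convex_set (C i).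
Hypothesis mu_ge0 : 0 <= mu.
Hypothesis l_diff : forall x, differentiable l x.
Hypothesis l_convex :
  convex_function setT (fun w : 'rV[R]_p => l w + kappa / 2 * enorm w ^+ 2).
Hypothesis kappa_lt : kappa < mu * m%:R.
Hypothesis f_coercive : coercive (penalized C l mu).
Variable x_ : nat -> 'rV[R]_p.
Hypothesis x_MM : MM_iterates C l mu x_.

Let f := penalized C l mu.

Let f_continuous : continuous f.
Proof.
move=> x; apply: differentiable_continuous.
exact: differentiable_penalized.
Qed.

Lemma MM_descent n :
  f (x_ n.+1) + (mu * m%:R - kappa) / 4 * enorm (x_ n - x_ n.+1) ^+ 2 <= f (x_ n).
Proof.
rewrite {2}/f -surrogate_diag//.
apply: le_trans (surrogate_strong_min _ _ _ kappa _ _ _ l_convex (x_MM n)).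
by rewrite lerD2r; exact: surrogate_majorizes.
Qed.

Lemma MM_nonincreasing : {homo (f \o x_) : n k / (n <= k)%N >-> k <= n}.
Proof.
apply/nonincreasing_seqP => n /=; apply: le_trans (MM_descent n).
by rewrite lerDl mulr_ge0 ?sqr_ge0// divr_ge0// subr_ge0 ltW.
Qed.

Lemma MM_steps_vanish e : 0 < e -> \forall n \near \oo, `|x_ n.+1 - x_ n| < e.
Proof.
move=> e0; have [z zmin] := coercive_argmin _ f_continuous f_coercive.
pose c := (mu * m%:R - kappa) / 4.
have c0 : 0 < c by rewrite divr_gt0// subr_gt0.
have ce0 : 0 < c * e ^+ 2 by rewrite mulr_gt0// exprn_gt0.
have := decrease_small _ (f \o x_) (f z) (c * e ^+ 2) _ _ ce0.
move=> /(_ (fun n => MM_nonincreasing _ _ (leqnSn n)) (fun n => zmin (x_ n))).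
apply: filterS => n /= fn; rewrite distrC.
apply: (le_lt_trans (mx_norm_le_enorm _)).
rewrite -ltr_sqr ?nnegrE ?enorm_ge0 ?(ltW e0)// -(ltr_pM2l c0).
by apply: le_lt_trans fn; rewrite lerBrDl; exact: MM_descent.
Qed.

(** Both f(z) <= f(x_n) and g(y | x_n) >= f(z) are closed conditions satisfied
along the sequence, hence at its cluster point z; the second one says that z
minimizes its own surrogate. *)
Lemma MM_cluster_stationary : cluster (x_ @ \oo) `<=` stationary f.
Proof.
move=> z xz; apply: fixed_point_stationary => // y; rewrite surrogate_diag//.
have f_le n : f z <= f (x_ n).
  apply: (@cluster_seq_closed _ x_ [set w | f w <= f (x_ n)]) xz.
    rewrite [X in closed X](_ : _ = f @^-1` `]-oo, f (x_ n)]%classic); last first.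
      by apply/seteqP; split=> w /=; rewrite in_itv.
    by apply: preimage_closed; [move=> w _; exact: f_continuous | exact: interval_closed].
  by exists n => // k /= nk; exact: MM_nonincreasing.
apply: (@cluster_seq_closed _ x_ [set w | f z <= surrogate C l mu w y]) xz.
  rewrite [X in closed X](_ : _ =
    (fun w => surrogate C l mu w y) @^-1` `[f z, +oo[%classic); last first.
    by apply/seteqP; split=> w /=; rewrite in_itv /= ?andbT.
  apply: preimage_closed; last exact: interval_closed.
  by move=> w _; exact: continuous_surrogate_anchor.
apply: nearW => n /=; apply: (le_trans (f_le n.+1)).
by apply: le_trans (x_MM n y); exact: surrogate_majorizes.
Qed.

Lemma MM_cvg : finite_set (stationary f) -> cvg (x_ @ \oo).
Proof.
move=> fin.
apply: (@cvg_seq_finite_cluster _ _ [set y | f y <= f (x_ 0%N)]).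
- exact: coercive_compact_sublevel.
- by move=> n; exact: MM_nonincreasing.
- exact: MM_steps_vanish.
- exact: sub_finite_set MM_cluster_stationary fin.
Qed.

(** The limit is a cluster point, and a global minimizer of f exists by coercivity;
both are stationary, hence equal to z. *)
Lemma MM_cvg_unique z : stationary f = [set z] -> x_ @ \oo --> z /\ argmin f z.
Proof.
move=> fz; have /cvg_ex[w xw] : cvg (x_ @ \oo).
  by apply: MM_cvg; rewrite fz; exact: finite_set1.
have only_z v : stationary f v -> v = z by rewrite fz.
split.
  suff <- : w = z by [].
  apply/only_z/MM_cluster_stationary.
  by move=> A B uA /xw uB; exact: filter_ex (filterI uA uB).
have [v vmin] := coercive_argmin _ f_continuous f_coercive.
suff <- : v = z by [].
exact/only_z/argmin_penalized_stationary.
Qed.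

End Iterates.

Theorem proposition2 (R : realType) (p m : nat) (hm : (0 < m)%N)
    (C : 'I_m -> set 'rV[R]_p)
    (hC0 : forall i, C i !=set0)
    (hCclosed : forall i, closed (C i))
    (hCconvex : forall i, convex_set (C i))
    (l : 'rV[R]_p -> R) (kappa mu : R) (hkappa : 0 < kappa)
    (hl_C1 : continuously_differentiable l)
    (hl_convex : convex_function setT
       (fun x : 'rV[R]_p => l x + kappa / 2 * enorm x ^+ 2))
    (hcoercive : coercive (penalized C l kappa))
    (hmu : kappa < mu)
    (x_ : nat -> 'rV[R]_p)
    (hx : MM_iterates C l mu x_) :
  [/\ cluster (x_ @ \oo) `<=` stationary (penalized C l mu),
      finite_set (stationary (penalized C l mu)) -> cvg (x_ @ \oo)
    & forall z : 'rV[R]_p, stationary (penalized C l mu) = [set z] ->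
        x_ @ \oo --> z /\ argmin (penalized C l mu) z].
Proof.
have mu0 : 0 < mu by exact: lt_trans hmu.
have l_diff := hl_C1.1.
have kappa_lt : kappa < mu * m%:R.
  by apply: lt_le_trans hmu _; rewrite ler_peMr ?ler1n// ltW.
have f_coercive : coercive (penalized C l mu).
  move=> A; have [r fr] := hcoercive A; exists r => x /fr /lt_le_trans; apply.
  rewrite lerD2l; apply: ler_wpM2r; last by rewrite ler_pM2r ?invr_gt0 ?ltW.
  by apply: sumr_ge0 => i _; exact: sqr_ge0.
split=> [||z].
- by apply: MM_cluster_stationary; eauto using ltW.
- by apply: MM_cvg; eauto using ltW.
- by apply: MM_cvg_unique; eauto using ltW.
Qed.
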